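(* For every integer $k\ge 0$, $|\mathcal{U}_{2k+1}(312,3421)|=\frac{1}{2k+1}\binom{3k}{k}$.
   Context: West's stack-sorting map $s$ is defined recursively on finite sequences of distinct positive integers: $s$ sends the empty sequence to itself, and if $\pi$ is a nonempty such sequence with largest entry $n$, writing $\pi=LnR$ one sets $s(\pi)=s(L)s(R)n$. A permutation $\pi\in S_n$ (one-line notation) is uniquely sorted if exactly one permutation $\sigma\in S_n$ satisfies $s(\sigma)=\pi$. Let $\mathcal{U}_n$ be the set of uniquely sorted permutations in $S_n$. A permutation $\pi$ contains a pattern $\tau\in S_m$ if some subsequence of $\pi$ of length $m$ has its entries in the same relative order as $\tau$; otherwise $\pi$ avoids $\tau$. $\mathcal{U}_{n}(\tau^{(1)},\dots,\tau^{(\ell)})$ denotes the set of permutations in $\mathcal{U}_n$ avoiding all of $\tau^{(1)},\dots,\tau^{(\ell)}$. *)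

(* Defs.v *)
From mathcomp Require Import all_boot all_fingroup.

Set Implicit Arguments.
Unset Strict Implicit.
Unset Printing Implicit Defensive.

Definition max_entry (w : seq nat) : nat := \max_(x <- w) x.

(* The first argument bounds the recursion depth; [size w] always suffices,
   see [stack_sort_cat]. *)
Fixpoint stack_sort_rec (fuel : nat) (w : seq nat) : seq nat :=
  if fuel is fuel'.+1 then
    if w is [::] then [::] else
    let n := max_entry w in
    let i := index n w in
    stack_sort_rec fuel' (take i w) ++ stack_sort_rec fuel' (drop i.+1 w) ++ [:: n]
  else [::].

Definition stack_sort (w : seq nat) : seq nat := stack_sort_rec (size w) w.

Lemma stack_sort_rec_cat fuel L n R :
  all (fun x => x < n) (L ++ R) ->
  stack_sort_rec fuel.+1 (L ++ n :: R) =
  stack_sort_rec fuel L ++ stack_sort_rec fuel R ++ [:: n].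
Proof.
rewrite all_cat => /andP[ltL ltR].
have maxE : max_entry (L ++ n :: R) = n.
  apply/eqP; rewrite eqn_leq; apply/andP; split.
    apply/bigmax_leqP_seq => x; rewrite mem_cat inE => /or3P[xL|/eqP->|xR] _ //.
      exact/ltnW/(allP ltL).
    exact/ltnW/(allP ltR).
  by apply: (leq_bigmax_seq (F := id)); rewrite // mem_cat inE eqxx orbT.
have nL : n \notin L by apply/negP => /(allP ltL); rewrite ltnn.
have idx : index n (L ++ n :: R) = size L.
  by rewrite index_cat (negPf nL) /= eqxx addn0.
have tk : take (size L) (L ++ n :: R) = L by rewrite take_size_cat.
have dr : drop (size L).+1 (L ++ n :: R) = R.
  by rewrite -cat_rcons drop_size_cat ?size_rcons.
have step w : w != [::] -> stack_sort_rec fuel.+1 w =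
    stack_sort_rec fuel (take (index (max_entry w) w) w) ++
    stack_sort_rec fuel (drop (index (max_entry w) w).+1 w) ++ [:: max_entry w].
  by case: w.
by rewrite step ?maxE ?idx ?tk ?dr //; case: (L).
Qed.

Lemma stack_sort_rec_fuel f (w : seq nat) : uniq w -> size w <= f ->
  stack_sort_rec f w = stack_sort w.
Proof.
rewrite /stack_sort; move: {2}(size w) (leqnn (size w)) => m.
elim: m f w => [|m IH] f w; first by case: w => //; case: f.
case: w => [|a w]; first by case: f.
move=> szm uw; case: f => // f szf.
have maxin : max_entry (a :: w) \in a :: w.
  rewrite /max_entry; elim: (w) a {uw szm szf} => [|b v IHv] a.
    by rewrite big_seq1 mem_seq1.
  rewrite big_cons inE; case: (leqP a (\max_(x <- b :: v) x)) => [_|lt].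
    by rewrite IHv orbT.
  by rewrite eqxx.
have maxge x : x \in a :: w -> x <= max_entry (a :: w).
  by move=> xw; apply: (leq_bigmax_seq (F := id)).
move: maxge maxin; move: (max_entry _) => n maxge nw.
move: uw szm szf maxge; case/splitPr: nw => L R uw szm szf maxge.
have ltn_ : all (fun x => x < n) (L ++ R).
  apply/allP => x xLR; rewrite ltn_neqAle maxge; last first.
    by move: xLR; rewrite !mem_cat inE => /orP[]->; rewrite ?orbT.
  rewrite andbT; apply/eqP => xn; move: uw xLR; rewrite xn uniq_catC cons_uniq.
  by rewrite !mem_cat orbC => /andP[/negPf->].
move: uw; rewrite cat_uniq /= => /and3P[uL _ /andP[_ uR]].
move: szm szf; rewrite size_cat /= addnS !ltnS => szm szf.
rewrite -[LHS]/(stack_sort_rec f.+1 (L ++ n :: R)) !stack_sort_rec_cat //.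
have sLm := leq_trans (leq_addr (size R) (size L)) szm.
have sRm := leq_trans (leq_addl (size L) (size R)) szm.
have sLf := leq_trans (leq_addr (size R) (size L)) szf.
have sRf := leq_trans (leq_addl (size L) (size R)) szf.
by rewrite !(IH f) // !(IH (size L + size R)) // ?leq_addr ?leq_addl.
Qed.

Lemma stack_sort_nil : stack_sort [::] = [::].
Proof. by []. Qed.

Lemma stack_sort_cat (L : seq nat) n (R : seq nat) :
  uniq (L ++ n :: R) -> all (fun x => x < n) (L ++ R) ->
  stack_sort (L ++ n :: R) = stack_sort L ++ stack_sort R ++ [:: n].
Proof.
move=> uw ltn_; rewrite {1}/stack_sort size_cat /= addnS stack_sort_rec_cat //.
move: uw; rewrite cat_uniq /= => /and3P[uL _ /andP[_ uR]].
by rewrite !stack_sort_rec_fuel // ?leq_addr ?leq_addl.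
Qed.

(* The entries are 1, ..., n, whereas 'I_n is {0, ..., n-1}. *)
Definition one_line n (p : 'S_n) : seq nat := [seq (p i).+1 | i <- enum 'I_n].

Definition uniquely_sorted n (p : 'S_n) : bool :=
  #|[set q : 'S_n | stack_sort (one_line q) == one_line p]| == 1.

Definition same_relative_order (u v : seq nat) : bool :=
  (size u == size v) &&
  [forall i : 'I_(size u), forall j : 'I_(size u),
     (nth 0 u i < nth 0 u j) == (nth 0 v i < nth 0 v j)].

(* [mask m w], for m a bit vector, ranges over the subsequences of w; the
   pattern tau is given in one-line notation. *)
Definition contains_pattern (w tau : seq nat) : bool :=
  [exists m : (size w).-tuple bool, same_relative_order (mask m w) tau].

Definition avoids_all (w : seq nat) (taus : seq (seq nat)) : bool :=
  all (fun tau => ~~ contains_pattern w tau) taus.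

Definition U n (taus : seq (seq nat)) : {set 'S_n} :=
  [set p : 'S_n | uniquely_sorted p && avoids_all (one_line p) taus].

(* Main.v *)
Require Import Defs.
From mathcomp Require Import all_boot all_order all_algebra all_fingroup.
From mathcomp Require Import zify.

(** A sorted word is s(L) s(R) n with n its maximum. By induction, reading the
    descents of such a word as up steps and its ascents as down steps gives a
    nonnegative path from some height down to 0. An empty L or R, or an ascent
    between s(L) and s(R), yields a second preimage, so a uniquely sorted word
    gives a Dyck path. Conversely, in a 312-avoiding word a last entry reached
    by an ascent is the maximum, so the last return of a Dyck path to the axis
    determines s(L) and s(R), and the preimage is unique by induction.

    An entry can be put in front of a word avoiding 312 and 3421, keeping these
    patterns out, in at most three ways: as the new minimum, as the second
    smallest entry (unless the word starts with its minimum), or just above the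
    current first entry. The first two create an ascent, the last a descent.
    Let Y_h be the generating function, by number of up steps, of the words
    whose path starts at height h; then Y_h = 2 Y_(h-1) - Y_(h-2) + x Y_(h+1)
    with Y_(-1) = Y_(-2) = 1. It is solved by polynomials in T, where
    T = 1 + x T^3, with Y_0 = T, and T counts ternary trees. *)

Set Implicit Arguments.
Unset Strict Implicit.
Unset Printing Implicit Defensive.

(** * Words read as lattice paths *)

Fixpoint dyck h (w : seq nat) : bool :=
  if w is x :: w' then
    if w' is y :: _ then
      if y < x then dyck h.+1 w' else (0 < h) && dyck h.-1 w'
    else h == 0
  else false.

Lemma dyck_cons2 h x y w : dyck h [:: x, y & w] =
  if y < x then dyck h.+1 (y :: w) else (0 < h) && dyck h.-1 (y :: w).
Proof. by []. Qed.

(** The word fixes the steps and the path ends at height 0, so reading backwards fixes every height.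
    A second starting height for one word is the usual contradiction below. *)
Lemma dyck_inj a b w : dyck a w -> dyck b w -> a = b.
Proof.
elim: w a b => [//|x [|y w] IH] a b; first by move=> /eqP-> /eqP->.
rewrite !dyck_cons2; case: ifP => _.
  by move=> da db; case: (IH _ _ da db).
by move=> /andP[a0 da] /andP[b0 db]; have := IH _ _ da db; lia.
Qed.

(** The two words overlap in [last x A]; the first path, lifted by [c], ends where the second
    begins. *)
Lemma dyck_cat a c x A B :
  dyck a (x :: A) -> dyck c (last x A :: B) -> dyck (a + c) (x :: A ++ B).
Proof.
elim: A a x => [|y A IH] a x; first by move=> /eqP->.
rewrite cat_cons !dyck_cons2; case: ifP => _.
  by move=> da dc; rewrite -addSn; apply: IH.
case: a => //= a da dc; exact: IH.
Qed.

Lemma dyck_suffix h x A B :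
  dyck h (x :: A ++ B) -> exists g, dyck g (last x A :: B).
Proof.
elim: A h x => [|y A IH] h x; first by exists h.
rewrite cat_cons dyck_cons2; case: ifP => _; first exact: IH.
by move=> /andP[_]; apply: IH.
Qed.

Lemma dyck_rcons h x s n : last x s < n -> dyck h (x :: s) ->
  dyck h.+1 (x :: rcons s n).
Proof.
move=> lt d; rewrite -cats1 -addn1; apply: dyck_cat => //=.
by rewrite ltnNge ltnW.
Qed.

(** This is the shape s(L) s(R) n. The final ascent raises the start of [y :: B] to [b + 1], and the
    step into [y] shifts this by one. Height 0 thus requires a descent between two Dyck words. *)
Lemma dyck_join x A y B n a b : last y B < n -> last x A != y ->
  dyck a (x :: A) -> dyck b (y :: B) ->
  dyck (if last x A < y then (a + b).+2 else a + b) (x :: A ++ y :: rcons B n).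
Proof.
move=> Bn xy dA dB; have dBn := dyck_rcons Bn dB.
case: ltnP => lt.
  have -> : (a + b).+2 = a + b.+2 by lia.
  by apply: dyck_cat; rewrite ?dyck_cons2 // ltnNge ltnW.
by apply: dyck_cat; rewrite ?dyck_cons2 // ltn_neqAle lt eq_sym xy.
Qed.

(* Cuts a path at its last return to the axis. *)
Lemma dyck_split h x w n : dyck h (x :: rcons w n) ->
  last x w <= n /\
  (0 < h /\ dyck h.-1 (x :: w) \/
   exists a A b B, [/\ x :: w = (a :: A) ++ b :: B, dyck h (a :: A),
                       dyck 0 (b :: B) & b < last a A]).
Proof.
elim: w h x => [|y w IH] h x.
  by rewrite /=; case: (ltnP n x) => // xn /andP[h0 h1]; split=> //; left.
rewrite rcons_cons dyck_cons2; case: ltnP => yx.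
  move=> /IH[ln [[h0 dyw]|[a [A [b [B [E dA dB lt]]]]]]]; split=> //.
    case: h h0 dyw => [|h] _ dyw; last by left; rewrite dyck_cons2 yx.
    (* The path starts on the axis and stays above it until [n], so the first piece is [x] alone. *)
    by right; exists x, [::], y, w; split.
  right; exists x, (a :: A), b, B; split=> //; first by rewrite E.
  by case: E dA => <- _ dA; rewrite dyck_cons2 yx.
move=> /andP[h0] /IH[ln [[h1 dyw]|[a [A [b [B [E dA dB lt]]]]]]]; split=> //.
  by left; rewrite dyck_cons2 [y < x]ltnNge yx h1.
right; exists x, (a :: A), b, B; split=> //; first by rewrite E.
by case: E dA => <- _ dA; rewrite dyck_cons2 [y < x]ltnNge yx h0.
Qed.

(** * Preimages under stack-sorting *)

Lemma max_split (w : seq nat) : w != [::] -> uniq w ->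
  exists L n R, w = L ++ n :: R /\ all (fun x => x < n) (L ++ R).
Proof.
elim: w => [//|x [|y w] IH] _; first by exists [::], x, [::].
rewrite cons_uniq => /andP[xw /(IH isT)[L [n [R [E lt]]]]].
case: (ltnP x n) => xn; first by exists (x :: L), n, R; rewrite E /= xn.
have {xn} nx : n < x.
  rewrite ltn_neqAle xn andbT; apply: contraNneq xw => <-.
  by rewrite E mem_cat mem_head orbT.
exists [::], x, (y :: w); split=> //; rewrite E /=.
move: lt; rewrite !all_cat /= nx => /andP[ltL ltR].
by rewrite !(sub_all _ ltL, sub_all _ ltR) // => z zn; apply: ltn_trans nx.
Qed.

Lemma uniq_parts (L : seq nat) n R : uniq (L ++ n :: R) -> uniq L /\ uniq R.
Proof. by rewrite cat_uniq /= => /and3P[uL _ /andP[_ uR]]. Qed.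

Lemma all_last (a : pred nat) x w : all a (x :: w) -> a (last x w).
Proof. by move/allP; apply; apply: mem_last. Qed.

Lemma all_lt_notin n (w : seq nat) : all (fun x => x < n) w -> n \notin w.
Proof. by move=> lt; apply/negP => /(allP lt); rewrite ltnn. Qed.

Lemma uniq_insert (L : seq nat) n R :
  all (fun x => x < n) (L ++ R) -> uniq (L ++ n :: R) = uniq (L ++ R).
Proof.
move=> lt; rewrite (perm_uniq (permEl (perm_catCA L [:: n] R))) /=.
by rewrite all_lt_notin.
Qed.

Lemma stack_sort_perm w : uniq w -> perm_eq (stack_sort w) w.
Proof.
elim: {w}(size w) {-2}w (leqnn (size w)) => [|m IH] w; first by case: w.
case: (eqVneq w [::]) => [->//|w0] szw uw.
have [L [n [R [E lt]]]] := max_split w0 uw; move: uw szw; rewrite {}E => uw.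
rewrite size_cat /= addnS ltnS => szm; have [uL uR] := uniq_parts uw.
rewrite stack_sort_cat // catA cats1 perm_rcons.
rewrite perm_sym (permPl (permEl (perm_catCA L [:: n] R))) perm_cons perm_sym.
apply: perm_cat; apply: IH => //.
  exact: leq_trans (leq_addr _ _) szm.
exact: leq_trans (leq_addl _ _) szm.
Qed.

Lemma mem_stack_sort w : uniq w -> stack_sort w =i w.
Proof. by move=> uw; apply/perm_mem/stack_sort_perm. Qed.

Lemma all_stack_sort a w : uniq w -> all a (stack_sort w) = all a w.
Proof. by move=> uw; apply/perm_all/stack_sort_perm. Qed.

Lemma size_stack_sort w : uniq w -> size (stack_sort w) = size w.
Proof. by move=> uw; apply/perm_size/stack_sort_perm. Qed.

Lemma stack_sort_split w : w != [::] -> uniq w ->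
  exists L n R, [/\ w = L ++ n :: R, all (fun x => x < n) (L ++ R),
    uniq L, uniq R & stack_sort w = stack_sort L ++ rcons (stack_sort R) n].
Proof.
move=> w0 uw; have [L [n [R [E lt]]]] := max_split w0 uw.
move: uw; rewrite {}E => uw; have [uL uR] := uniq_parts uw.
by exists L, n, R; split=> //; rewrite stack_sort_cat // cats1.
Qed.

Lemma stack_sort_eq0 w : uniq w -> (stack_sort w == [::]) = (w == [::]).
Proof. by move=> uw; rewrite -!size_eq0 size_stack_sort. Qed.

Lemma stack_sort_dyck w : w != [::] -> uniq w -> exists h, dyck h (stack_sort w).
Proof.
elim: {w}(size w) {-2}w (leqnn (size w)) => [|m IH] w; first by case: w.
move=> szw w0 uw; have [L [n [R [E lt uL uR Es]]]] := stack_sort_split w0 uw.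
move: szw uw; rewrite {}Es {}E size_cat /= addnS ltnS => szm uw.
have szL := leq_trans (leq_addr (size R) (size L)) szm.
have szR := leq_trans (leq_addl (size L) (size R)) szm.
have := IH L szL ^~ uL; have := IH R szR ^~ uR.
rewrite -(stack_sort_eq0 uL) -(stack_sort_eq0 uR).
have : all (fun x => x < n) (stack_sort L ++ stack_sort R).
  by rewrite all_cat !all_stack_sort // -all_cat.
have : uniq (stack_sort L ++ stack_sort R).
  rewrite (perm_uniq (perm_cat (stack_sort_perm uL) (stack_sort_perm uR))).
  by rewrite -(uniq_insert lt).
case: (stack_sort L) (stack_sort R) => [|a A] [|b B] uAB ltAB.
- by exists 0.
- move=> [//|h dB] _; exists h.+1; apply: dyck_rcons => //.
  exact: (all_last ltAB).
- move=> _ [//|h dA]; exists h.+1; rewrite cats1; apply: dyck_rcons => //.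
  by rewrite cats0 in ltAB; apply: (all_last ltAB).
move=> [//|h dB] [//|g dA].
exists (if last a A < b then (g + h).+2 else g + h); apply: dyck_join => //.
  by move: ltAB; rewrite all_cat => /andP[_ /all_last].
move: uAB; rewrite cat_uniq => /and3P[_ /hasPn nAB _].
by apply: contraNneq (nAB b (mem_head _ _)) => <-; apply: mem_last.
Qed.

(** Preimages range over all words without repetition, so that the notion applies to s(L) and s(R),
    whose entries need not be an initial segment. *)
Definition unique_preimage w :=
  exists2 v, uniq v /\ stack_sort v = w &
    forall u, uniq u -> stack_sort u = w -> u = v.

(** Write R = C n D. The last entry of s(L) is the maximum of L and lies below [b <= n], so [n]
    exceeds all of L. If C is empty, L n D is a preimage; otherwise s(C) also starts with [b], and
    induction merges L and C. *)
Lemma sorted_cat L R a A b B : uniq (L ++ R) ->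
  stack_sort L = a :: A -> stack_sort R = b :: B -> last a A < b ->
  exists2 v, uniq v & stack_sort v = (a :: A) ++ b :: B.
Proof.
elim: {R}(size R) {-2}R (leqnn (size R)) B => [|m IH] R; first by case: R.
move=> szR B uLR EA EB ltab.
have [uL _ uR] : [/\ uniq L, True & uniq R].
  by move: uLR; rewrite cat_uniq => /and3P[].
have R0 : R != [::] by rewrite -stack_sort_eq0 // EB.
have [C [n [D [E lt uC uD Es]]]] := stack_sort_split R0 uR.
have bn : b <= n.
  have: all (fun x => x <= n) (stack_sort R).
    rewrite all_stack_sort // E all_cat /= leqnn.
    move: lt; rewrite all_cat => /andP[ltC ltD].
    by rewrite (sub_all _ ltC) ?(sub_all _ ltD) // => x /ltnW.
  by rewrite EB /= => /andP[].
have ltL : all (fun x => x < n) L.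
  rewrite -all_stack_sort //.
  have L0 : L != [::] by rewrite -stack_sort_eq0 // EA.
  have [C' [n' [D' [E' lt' uC' uD' Es']]]] := stack_sort_split L0 uL.
  have n'n : n' < n.
    apply: leq_trans bn; move: ltab.
    have -> // : last a A = n'.
    by rewrite -[last a A]/(last 0 (a :: A)) -EA Es' last_cat last_rcons.
  rewrite all_stack_sort // E' all_cat /= n'n.
  move: lt'; rewrite all_cat => /andP[ltC ltD].
  by rewrite (sub_all _ ltC) ?(sub_all _ ltD) // => x /ltn_trans; apply.
move: uLR szR EB; rewrite Es {}E size_cat /= addnS ltnS => uLR szR.
have uLCD : uniq (L ++ C ++ D).
  by move: uLR; rewrite !catA uniq_insert // -catA all_cat ltL.
case EC: (stack_sort C) => [|c C1] EB.
  have /eqP C0 : C == [::] by rewrite -stack_sort_eq0 ?EC.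
  subst C; exists (L ++ n :: D) => //.
  rewrite stack_sort_cat //; last by rewrite all_cat ltL.
  by rewrite EA cats1 -EB.
case: EB => cb EB; subst c.
have uLC : uniq (L ++ C) by move: uLCD; rewrite catA cat_uniq => /andP[].
have [v uv Ev] := IH C (leq_trans (leq_addr _ _) szR) C1 uLC EA EC ltab.
have pv : perm_eq v (L ++ C).
  rewrite -(permPl (stack_sort_perm uv)) Ev -EA -EC.
  exact: perm_cat (stack_sort_perm uL) (stack_sort_perm uC).
have ltv : all (fun x => x < n) (v ++ D).
  rewrite all_cat (perm_all _ pv) -all_cat -catA all_cat ltL.
  exact: lt.
have uvD : uniq (v ++ n :: D).
  by rewrite uniq_insert // (perm_uniq (perm_cat pv (perm_refl D))) -catA.
exists (v ++ n :: D) => //.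
by rewrite stack_sort_cat // Ev cats1 -EB -catA.
Qed.

Lemma dyck_of_unique_preimage w : w != [::] -> unique_preimage w -> dyck 0 w.
Proof.
move=> w0 [v [uv Ev] unv]; move: w0; rewrite -{w}Ev in unv *.
rewrite stack_sort_eq0 //.
elim: {v}(size v) {-2}v (leqnn (size v)) uv unv => [|m IH] v; first by case: v.
move=> szv uv unv v0.
have [L [n [R [E lt uL uR Es]]]] := stack_sort_split v0 uv.
move: szv uv unv; rewrite Es {}E size_cat /= addnS ltnS => szm uv unv.
have szL := leq_trans (leq_addr (size R) (size L)) szm.
have szR := leq_trans (leq_addl (size L) (size R)) szm.
have uLR : uniq (L ++ R) by rewrite -(uniq_insert lt).
have [ltL ltR] : all (fun x => x < n) L /\ all (fun x => x < n) R.
  by apply/andP; rewrite -all_cat.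
(* A nonempty sorted word Q followed by its maximum n comes from both Qn and nQ. *)
have nosplit Q : uniq Q -> all (fun x => x < n) Q -> Q != [::] ->
    stack_sort Q = stack_sort L ++ stack_sort R -> False.
  move=> uQ ltQ Q0 EQ.
  have E1 : Q ++ [:: n] = L ++ n :: R.
    apply: unv; first by rewrite uniq_insert cats0.
    by rewrite stack_sort_cat ?uniq_insert ?cats0 // EQ /= -cats1 catA.
  have E2 : [::] ++ n :: Q = L ++ n :: R.
    apply: unv; first by rewrite uniq_insert.
    by rewrite stack_sort_cat ?uniq_insert // EQ /= -cats1 catA.
  case: Q Q0 ltQ E1 E2 {uQ EQ} => //= q Q _ /andP[qn _].
  by move=> <- [E]; move: qn; rewrite E ltnn.
case: (eqVneq L [::]) => [L0|L0].
  case: (eqVneq R [::]) => [R0|R0]; first by rewrite L0 R0.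
  by case: (nosplit R); rewrite // L0.
case: (eqVneq R [::]) => [R0|R0].
  by case: (nosplit L); rewrite // R0 cats0.
(* Another preimage of s(L) could replace [L] in the preimage of the whole word; likewise for [R]
   below. *)
have dL : dyck 0 (stack_sort L).
  apply: IH => // u uu Eu.
  have pu : perm_eq u L.
    by rewrite -(permPl (stack_sort_perm uu)) Eu stack_sort_perm.
  have ltu : all (fun x => x < n) (u ++ R).
    by rewrite all_cat (perm_all _ pu) -all_cat.
  have uuR : uniq (u ++ R) by rewrite (perm_uniq (perm_cat pu (perm_refl R))).
  have /eqP : u ++ n :: R = L ++ n :: R.
    apply: unv; first by rewrite uniq_insert.
    by rewrite stack_sort_cat ?uniq_insert // Eu cats1.
  by rewrite eqseq_cat ?(perm_size pu) // => /andP[/eqP].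
have dR : dyck 0 (stack_sort R).
  apply: IH => // u uu Eu.
  have pu : perm_eq u R.
    by rewrite -(permPl (stack_sort_perm uu)) Eu stack_sort_perm.
  have ltu : all (fun x => x < n) (L ++ u).
    by rewrite all_cat (perm_all _ pu) -all_cat.
  have uuR : uniq (L ++ u) by rewrite (perm_uniq (perm_cat (perm_refl L) pu)).
  have /eqP : L ++ n :: u = L ++ n :: R.
    apply: unv; first by rewrite uniq_insert.
    by rewrite stack_sort_cat ?uniq_insert // Eu cats1.
  by rewrite eqseq_cat // => /andP[_ /eqP[]].
case EL: (stack_sort L) dL => [//|a A] dA.
case ER: (stack_sort R) dR => [//|b B] dB.
have ltB : last b B < n.
  by apply: (@all_last (fun x => x < n)); rewrite -ER all_stack_sort.
have nab : last a A != b.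
  move: uLR; rewrite cat_uniq => /and3P[_ /hasPn nAB _].
  apply: contraNneq (nAB b _) => [<-|].
    by rewrite -mem_stack_sort // EL mem_last.
  by rewrite -mem_stack_sort // ER mem_head.
(* A descent gives height 0. After an ascent s(L) s(R) would itself be sorted, which [nosplit]
   forbids. *)
have := dyck_join ltB nab dA dB; case: ltnP => [ltab _|_ //].
have [Q uQ EQ] := sorted_cat uLR EL ER ltab.
case: (nosplit Q) => //; last by rewrite EQ EL ER.
  by rewrite -all_stack_sort // EQ -EL -ER all_cat !all_stack_sort // ltL.
by rewrite -stack_sort_eq0 // EQ.
Qed.
Definition avoids312 (w : seq nat) := forall a b c,
  subseq [:: a; b; c] w -> b < c -> c < a -> False.

Definition avoids3421 (w : seq nat) := forall a b c d,
  subseq [:: a; b; c; d] w -> d < c -> c < a -> a < b -> False.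

Lemma avoids312_subseq v w : subseq v w -> avoids312 w -> avoids312 v.
Proof. by move=> vw av a b c /subseq_trans/(_ vw); apply: av. Qed.

(** An entry above [n] would form 312 with the last two entries, which ascend. *)
Lemma avoids312_rcons_max x w n : uniq (x :: rcons w n) ->
  avoids312 (x :: rcons w n) -> last x w <= n ->
  all (fun y => y < n) (x :: w).
Proof.
rewrite -rcons_cons rcons_uniq => /andP[nw _] av ln; apply/allP => z zw.
have zn : z != n by apply: contraNneq nw => <-.
rewrite ltn_neqAle zn leqNgt; apply/negP => nz.
have {}ln : last x w < n.
  rewrite ltn_neqAle ln andbT.
  by apply: contraNneq nw => <-; apply: mem_last.
apply: (av z (last x w) n) => //.
move: zw; rewrite lastI mem_rcons inE => /orP[/eqP zl|zb].
  by move: nz; rewrite zl ltnNge (ltnW ln).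
rewrite -!cats1 -catA -[[:: z; _; _]]/([:: z] ++ [:: last x w; n]).
by apply: cat_subseq; rewrite ?sub1seq.
Qed.

(** If the second cut came later, the path of [b :: B] would reach [b'] by a descent, hence at a
    positive height, whereas [b' :: B'] starts at height 0. *)
Lemma last_return_unique A a B b A' a' B' b' :
  (a :: A) ++ b :: B = (a' :: A') ++ b' :: B' ->
  dyck 0 (b :: B) -> dyck 0 (b' :: B') -> b' < last a' A' ->
  size A' <= size A.
Proof.
move=> E dB dB' lt; rewrite leqNgt; apply/negP => ltA.
have := drop_size_cat (b :: B) (erefl (size (a :: A))).
rewrite E drop_cat [size (a :: A)]/= [size (a' :: A')]/= ltnS ltA => EB.
move: dB; rewrite -EB; case ED: (drop _ _) => [|c C].
  by move/(congr1 size): ED; rewrite size_drop /=; lia.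
move=> /dyck_suffix[g].
have -> : last c C = last a' A'.
  rewrite -[RHS]/(last 0 (a' :: A')) -(cat_take_drop (size A).+1 (a' :: A')).
  by rewrite ED last_cat.
by rewrite dyck_cons2 lt => /(dyck_inj dB').
Qed.

Lemma unique_preimage_of_dyck w :
  uniq w -> avoids312 w -> dyck 0 w -> unique_preimage w.
Proof.
elim: {w}(size w) {-2}w (leqnn (size w)) => [|m IH] w; first by case: w.
case: (lastP w) => // {}w n; rewrite size_rcons ltnS; case: w => [|x w] szw uw av.
  move=> _; exists [:: n] => [|u uu Eu].
    by split=> //; apply: (@stack_sort_cat [::] n [::]).
  have /perm_small_eq -> // : perm_eq u [:: n].
  by rewrite -[[:: n]]/(rcons [::] n) -Eu perm_sym stack_sort_perm.
rewrite rcons_cons => dw.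
have [/(avoids312_rcons_max uw av) lt [[]//|]] := dyck_split dw.
move=> [a [A [b [B [Ew dA dB ltb]]]]].
have {uw}uAB : uniq ((a :: A) ++ b :: B).
  by move: uw; rewrite rcons_uniq -Ew => /andP[].
move: szw av dw lt; rewrite -rcons_cons Ew size_cat => szw av dw lt.
have [uA uB] : uniq (a :: A) /\ uniq (b :: B).
  by move: uAB; rewrite cat_uniq => /and3P[].
have szA : size (a :: A) <= m by apply: leq_trans szw; rewrite leq_addr.
have szB : size (b :: B) <= m by apply: leq_trans szw; rewrite leq_addl.
have subA : subseq (a :: A) (rcons ((a :: A) ++ b :: B) n).
  by rewrite rcons_cat prefix_subseq.
have subB : subseq (b :: B) (rcons ((a :: A) ++ b :: B) n).
  by rewrite -cats1 -catA; apply: subseq_trans (suffix_subseq _ _);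
     apply: prefix_subseq.
have [L [uL EL] unL] := IH _ szA uA (avoids312_subseq subA av) dA.
have [R [uR ER] unR] := IH _ szB uB (avoids312_subseq subB av) dB.
have pLR : perm_eq (L ++ R) ((a :: A) ++ b :: B).
  by rewrite -EL -ER perm_sym perm_cat ?stack_sort_perm.
have ltLR : all (fun y => y < n) (L ++ R) by rewrite (perm_all _ pLR).
have uLR : uniq (L ++ R) by rewrite (perm_uniq pLR).
exists (L ++ n :: R).
  by rewrite uniq_insert // stack_sort_cat ?uniq_insert // EL ER cats1 rcons_cat.
move=> u uu Eu; have u0 : u != [::] by rewrite -stack_sort_eq0 // Eu.
have [L' [n' [R' [E' lt' uL' uR' Es']]]] := stack_sort_split u0 uu.
move: Eu; rewrite Es' -rcons_cat => /rcons_inj[Eu En].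
move: uu u0; rewrite {}E' {}En {Es'} in lt' * => uu _.
have lt2 : all (fun y => y < n) (stack_sort L' ++ stack_sort R').
  by rewrite Eu.
have u2 : uniq (stack_sort L' ++ stack_sort R') by rewrite Eu.
(* With [L'] empty the word would be s(R') followed by its maximum, whose path starts at a positive
   height; an empty [R'] fails in the same way. *)
have L'0 : L' != [::].
  apply/eqP => L'0; move: Eu; rewrite L'0 /= => Eu.
  have R'0 : R' != [::] by rewrite -stack_sort_eq0 // Eu.
  have [h] := stack_sort_dyck R'0 uR'; rewrite Eu => dh.
  have := dyck_rcons (all_last lt) dh.
  by move=> /(dyck_inj dw).
have R'0 : R' != [::].
  apply/eqP => R'0; move: Eu; rewrite R'0 cats0 => Eu.
  have [h] := stack_sort_dyck L'0 uL'; rewrite Eu => dh.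
  have := dyck_rcons (all_last lt) dh.
  by move=> /(dyck_inj dw).
have [g] := stack_sort_dyck L'0 uL'; have [h] := stack_sort_dyck R'0 uR'.
case EL': (stack_sort L') Eu lt2 u2 => [//|a' A'].
case ER': (stack_sort R') => [//|b' B'] Eu lt2 u2 dB' dA'.
have ltB' : last b' B' < n.
  by move: lt2; rewrite all_cat => /andP[_ /all_last].
have nab : last a' A' != b'.
  move: u2; rewrite cat_uniq => /and3P[_ /hasPn nAB _].
  by apply: contraNneq (nAB b' (mem_head _ _)) => <-; apply: mem_last.
have := dyck_join ltB' nab dA' dB'.
have -> : a' :: A' ++ b' :: rcons B' n = rcons ((a :: A) ++ b :: B) n.
  by rewrite -[RHS]/(rcons (a :: A ++ b :: B) n) -Eu /= rcons_cat.
(* An ascent between the pieces would make the path start at height at least 2. A descent forces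
   [g = h = 0]; both cuts are then the last return and coincide. *)
case: ltnP => [_ /(dyck_inj dw)//|lt_ba].
move=> /(dyck_inj dw)/esym/eqP; rewrite addn_eq0 => /andP[/eqP g0 /eqP h0].
rewrite {}g0 in dA'; rewrite {}h0 in dB'.
have {}lt_ba : b' < last a' A' by rewrite ltn_neqAle eq_sym nab.
have szAA : size (a' :: A') = size (a :: A).
  apply/eqP; rewrite eqn_leq /= !ltnS.
  by rewrite (last_return_unique Eu dB' dB) // (last_return_unique (esym Eu) dB dB').
have : (a' :: A') ++ b' :: B' == (a :: A) ++ b :: B by apply/eqP.
rewrite eqseq_cat // => /andP[/eqP EA /eqP EB].
by congr (_ ++ _ :: _); [apply: unL|apply: unR]; rewrite ?EL' ?ER'.
Qed.

(** * Permutations and their one-line words *)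

Lemma one_line_inj n : injective (@one_line n).
Proof.
move=> p q /eq_in_map E; apply/permP => i; apply/val_inj.
by have /succn_inj := E i (mem_enum _ i).
Qed.

Lemma uniq_one_line n (p : 'S_n) : uniq (one_line p).
Proof.
by rewrite map_inj_uniq ?enum_uniq // => i j /succn_inj/val_inj/perm_inj.
Qed.

Lemma one_line_perm n (p : 'S_n) : perm_eq (one_line p) (iota 1 n).
Proof.
have sub : {subset one_line p <= iota 1 n}.
  move=> y /mapP[i _ ->]; rewrite mem_iota; have := ltn_ord (p i); lia.
apply: uniq_perm; rewrite ?uniq_one_line ?iota_uniq //.
have [] := uniq_min_size (uniq_one_line p) sub; last by [].
by rewrite size_map size_iota size_enum_ord.
Qed.

Lemma one_line_surj n (w : seq nat) : perm_eq w (iota 1 n) ->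
  exists p : 'S_n, one_line p = w.
Proof.
move=> pw; have szw : size w = n by rewrite (perm_size pw) size_iota.
have uw : uniq w by rewrite (perm_uniq pw) iota_uniq.
have bd (i : 'I_n) : 0 < nth 0 w i < n.+1.
  have: nth 0 w i \in iota 1 n by rewrite -(perm_mem pw) mem_nth ?szw.
  by rewrite mem_iota; lia.
have lt (i : 'I_n) : (nth 0 w i).-1 < n by have := bd i; lia.
have inj : injective (fun i => Ordinal (lt i)).
  move=> i j [] eij; apply/val_inj/eqP; rewrite /= -(nth_uniq 0 _ _ uw) ?szw //.
  have eq_nth : nth 0 w i = nth 0 w j by have := bd i; have := bd j; lia.
  exact/eqP.
exists (perm inj); apply: (@eq_from_nth _ 0); first by rewrite size_map size_enum_ord.
move=> i; rewrite size_map size_enum_ord => ltin.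
rewrite (nth_map (Ordinal ltin)) ?size_enum_ord // permE /= nth_enum_ord //.
by rewrite prednK //; case/andP: (bd (Ordinal ltin)).
Qed.

(** Sorting only rearranges, so every preimage of a one-line word is again the one-line word of a
    permutation. *)
Lemma uniquely_sortedP n (p : 'S_n) :
  reflect (unique_preimage (one_line p)) (uniquely_sorted p).
Proof.
apply: (iffP idP) => [/cards1P[q Eq]|[v [uv Ev] unv]].
  have mem_q r : (stack_sort (one_line r) == one_line p) = (r == q).
    by move/setP/(_ r): Eq; rewrite !inE.
  exists (one_line q); first by split; [exact: uniq_one_line|apply/eqP; rewrite mem_q].
  move=> u uu Eu; have /one_line_surj[r Er] : perm_eq u (iota 1 n).
    by rewrite -(permPl (stack_sort_perm uu)) Eu one_line_perm.
  by move/eqP: Eu; rewrite -Er mem_q => /eqP->.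
have /one_line_surj[q Eq] : perm_eq v (iota 1 n).
  by rewrite -(permPl (stack_sort_perm uv)) Ev one_line_perm.
apply/cards1P; exists q; apply/setP => r; rewrite !inE; apply/eqP/eqP => [Er|->].
  by apply/one_line_inj; rewrite Eq; apply: unv Er; apply: uniq_one_line.
by rewrite Eq.
Qed.
(** * Words avoiding 312 and 3421 *)

Lemma contains_patternP w tau :
  reflect (exists2 v, subseq v w & same_relative_order v tau)
          (contains_pattern w tau).
Proof.
apply: (iffP existsP) => [[m om]|[_ /subseqP[m /eqP szm ->] om]].
  by exists (mask m w) => //; apply: mask_subseq.
by exists (Tuple szm).
Qed.

Lemma avoids312P w : reflect (avoids312 w) (~~ contains_pattern w [:: 3; 1; 2]).
Proof.
apply: (iffP idP) => [ct a b c sub bc ca|av].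
  case/contains_patternP: ct; exists [:: a; b; c] => //.
  rewrite /same_relative_order /=; apply/forallP => -[i lti].
  apply/forallP => -[j ltj]; apply/eqP.
  by case: i j lti ltj => [|[|[|i]]] [|[|[|j]]] //= _ _; lia.
apply/contains_patternP => -[[|a [|b [|c [|d v]]]] // sub] /andP[_ /forallP o].
have /eqP := forallP (o (@Ordinal 3 1 isT)) (@Ordinal 3 2 isT).
have /eqP := forallP (o (@Ordinal 3 2 isT)) (@Ordinal 3 0 isT).
exact/(fun lt1 lt2 => av _ _ _ sub lt2 lt1).
Qed.

Lemma avoids3421P w :
  reflect (avoids3421 w) (~~ contains_pattern w [:: 3; 4; 2; 1]).
Proof.
apply: (iffP idP) => [ct a b c d sub dc ca ab|av].
  case/contains_patternP: ct; exists [:: a; b; c; d] => //.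
  rewrite /same_relative_order /=; apply/forallP => -[i lti].
  apply/forallP => -[j ltj]; apply/eqP.
  by case: i j lti ltj => [|[|[|[|i]]]] [|[|[|[|j]]]] //= _ _; lia.
apply/contains_patternP => -[[|a [|b [|c [|d [|e v]]]]] // sub] /andP[_ /forallP o].
have /eqP lt1 := forallP (o (@Ordinal 4 3 isT)) (@Ordinal 4 2 isT).
have /eqP lt2 := forallP (o (@Ordinal 4 2 isT)) (@Ordinal 4 0 isT).
have /eqP lt3 := forallP (o (@Ordinal 4 0 isT)) (@Ordinal 4 1 isT).
exact: av sub lt1 lt2 lt3.
Qed.

Definition avoids w := avoids312 w /\ avoids3421 w.

Lemma avoids_allP w :
  reflect (avoids w) (avoids_all w [:: [:: 3; 1; 2]; [:: 3; 4; 2; 1]]).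
Proof.
by rewrite /avoids_all /= andbT; apply: (iffP andP) => -[/avoids312P ? /avoids3421P].
Qed.

Lemma avoids_small w : size w < 3 -> avoids w.
Proof. by move=> w3; split=> [a b c|a b c d] /size_subseq /=; lia. Qed.

Lemma avoids_subseq v w : subseq v w -> avoids w -> avoids v.
Proof.
move=> vw [av1 av2]; split; first exact: avoids312_subseq av1.
by move=> a b c d /subseq_trans/(_ vw); apply: av2.
Qed.

Lemma subseq_map_ex (f : nat -> nat) s w :
  subseq s (map f w) -> exists2 t, subseq t w & s = map f t.
Proof.
move=> /subseqP[m _ ->]; exists (mask m w); first exact: mask_subseq.
by rewrite map_mask.
Qed.

Lemma avoids_map f w : {mono f : x y / x < y} ->
  avoids (map f w) <-> avoids w.
Proof.
move=> fm; split=> -[av1 av2]; split.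
- move=> a b c /(map_subseq f)/av1; rewrite !fm; exact.
- move=> a b c d /(map_subseq f)/av2; rewrite !fm; exact.
- move=> a b c /subseq_map_ex[[|a' [|b' [|c' [|? ?]]]] // sub [-> -> ->]].
  by rewrite !fm; apply: av1.
move=> a b c d /subseq_map_ex[[|a' [|b' [|c' [|d' [|? ?]]]]] // sub [-> -> -> ->]].
by rewrite !fm; apply: av2.
Qed.

Lemma subseq2_total (b c : nat) w : b \in w -> c \in w -> b != c ->
  subseq [:: b; c] w || subseq [:: c; b] w.
Proof.
elim: w => // x w IH; rewrite !inE /=.
case: (eqVneq b x) => [<-|bx] /=; first by rewrite eq_sym sub1seq => _ /orP[->|->].
case: (eqVneq c x) => [_|cx] /=; first by rewrite sub1seq => -> _ _; rewrite orbT.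
exact: IH.
Qed.

(** A new pattern starts at [x]. If [y < x], an entry between them gives 312; without one, a pattern
    from [x] cannot use [y] and starts equally well at [y]. If [x < y], two later entries below [x]
    give 312 when they increase and 3421, with [y] as its 4, when they decrease; conversely, each
    pattern from [x] needs two such entries. *)
Lemma avoids_cons x y w : uniq [:: x, y & w] ->
  avoids [:: x, y & w] <->
  avoids (y :: w) /\
  if y < x then {in w, forall z, y < z -> x <= z}
  else {in w &, forall b c, b < x -> c < x -> b = c}.
Proof.
move=> /and3P[]; rewrite inE negb_or => /andP[xy xw] yw uw; split.
  move=> av; have [av1 av2] := av; split.
    by apply: avoids_subseq av; apply: subseq_cons.
  case: ltnP => [yx z zw yz|yx b c bw cw bx cx].
    rewrite leqNgt; apply/negP; apply: (av1 x y z) => //=.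
    by rewrite !eqxx sub1seq.
  apply/eqP; apply/negP => /negP bc.
  have two p q : subseq [:: p; q] w -> p != q -> p < x -> q < x -> False.
    move=> sub; case: (ltngtP p q) => // pq _ px qx.
      apply: (av1 x p q) => //; rewrite /= eqxx.
      exact: subseq_trans sub (subseq_cons _ _).
    apply: (av2 x y p q) => //; first by rewrite /= !eqxx.
    by rewrite ltn_neqAle xy.
  case/orP: (subseq2_total bw cw bc) => [/two|/two H]; first exact.
  by apply: H; rewrite // eq_sym.
move=> [[av1 av2] cond]; split=> [a b c|a b c d]; rewrite [subseq _ _]/=.
  case: (eqVneq a x) => [-> sub bc cx|_]; last exact: av1.
  case: (eqVneq b y) sub => [by_|by_] sub.
    rewrite sub1seq in sub; rewrite by_ in bc.
    move: cond; rewrite (ltn_trans bc cx) => /(_ c sub bc).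
    by rewrite leqNgt cx.
  have bw : b \in w by apply: (mem_subseq sub); rewrite mem_head.
  have cw : c \in w by apply: (mem_subseq sub); rewrite !inE eqxx orbT.
  case: ltnP cond => yx cond; last first.
    by have := cond b c bw cw (ltn_trans bc cx) cx; lia.
  apply: (av1 y b c) => //; first by rewrite /= eqxx.
  rewrite ltn_neqAle leqNgt; apply/andP; split.
    by apply: contraNneq yw => <-.
  by apply/negP => /(cond c cw); rewrite leqNgt cx.
case: (eqVneq a x) => [-> sub dc cx xb|_]; last exact: av2.
have [cw dw] : c \in w /\ d \in w.
  by case: (b == y) sub => sub; split; apply: (mem_subseq sub);
     rewrite !inE eqxx ?orbT.
case: ltnP cond => yx cond; last first.
  by have := cond c d cw dw cx (ltn_trans dc cx); lia.
case: (eqVneq b y) sub => [by_|_] sub; first by lia.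
apply: (av2 y b c d) => //; first by rewrite /= eqxx.
  rewrite ltn_neqAle leqNgt; apply/andP; split.
    by apply: contraNneq yw => <-.
  by apply/negP => /(cond c cw); rewrite leqNgt cx.
exact: ltn_trans xb.
Qed.

(** [bump x] raises the entries that are at least [x], which frees the value [x] and keeps the
    relative order. *)
Definition prepend x w : seq nat := x :: map (bump x) w.

Lemma ltn_bump x : {mono bump x : y z / y < z}.
Proof. by move=> y z; rewrite !ltnNge leq_bump2. Qed.

Lemma bump_inj x : injective (bump x).
Proof. exact: can_inj (bumpK x). Qed.

Lemma uniq_prepend x w : uniq (prepend x w) = uniq w.
Proof.
rewrite /= (map_inj_uniq (@bump_inj x)) andb_idl // => _.
by apply/mapP => -[y _ /eqP]; rewrite (negPf (neq_bump x y)).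
Qed.

Lemma prepend_perm x w n : 0 < x <= n.+1 ->
  perm_eq (prepend x w) (iota 1 n.+1) = perm_eq w (iota 1 n).
Proof.
move=> xn; have /permPr <- : perm_eq (prepend x (iota 1 n)) (iota 1 n.+1).
  have sub : {subset prepend x (iota 1 n) <= iota 1 n.+1}.
    move=> t; rewrite inE => /orP[/eqP->|/mapP[y]]; rewrite !mem_iota; first lia.
    by rewrite /bump => yn ->; lia.
  have upx : uniq (prepend x (iota 1 n)) by rewrite uniq_prepend iota_uniq.
  apply: uniq_perm; rewrite ?iota_uniq //.
  have [] := uniq_min_size upx sub; last by [].
  by rewrite /= size_map !size_iota.
rewrite perm_cons; apply/idP/idP; last exact: perm_map.
exact: (perm_map_inj (@bump_inj x)).
Qed.

(** For [y = 1] the values 2 and [y.+1] coincide; listing them once keeps [words] free of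
    repetitions. *)
Definition first_entries w :=
  if w is y :: _ then if y == 1 then [:: 1; y.+1] else [:: 1; 2; y.+1]
  else [:: 1].

Fixpoint words n : seq (seq nat) :=
  if n is n'.+1 then [seq prepend x w | w <- words n', x <- first_entries w]
  else [:: [::]].

Lemma avoids_prepend x w n : perm_eq w (iota 1 n) -> 0 < x <= n.+1 ->
  avoids (prepend x w) <-> avoids w /\ x \in first_entries w.
Proof.
move=> pw xn; have uw : uniq w by rewrite (perm_uniq pw) iota_uniq.
have mw z : (z \in w) = (0 < z < n.+1) by rewrite (perm_mem pw) mem_iota.
case: w pw uw mw => [|y w] pw uw mw.
  have n0 : n = 0 by have := perm_size pw; rewrite size_iota.
  rewrite inE (_ : x == 1) ?n0; last by lia.
  by split=> [_|_]; [split=> //|]; apply: avoids_small.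
have := uw; rewrite -(uniq_prepend x) => /avoids_cons.
rewrite -/(map (bump x) (y :: w)) => ->.
rewrite (avoids_map _ (ltn_bump x)); apply: and_iff_compat_l.
have [y0 yn] : 0 < y /\ y <= n by have := mw y; rewrite mem_head; lia.
have nyw : y \notin w by case/andP: uw.
have mw' z : z != y -> (z \in w) = (0 < z < n.+1).
  by move=> zy; rewrite -mw inE (negPf zy).
case: ltnP; rewrite {1}/bump => yx; split.
(* A larger [x] would leave the entry [y.+1] of [w] strictly between [y] and [x]. *)
- move=> cond; have xy : x = y.+1.
    apply/eqP; rewrite eqn_leq; apply/andP; split; last by lia.
    have yw : y.+1 \in w -> x <= bump x y.+1.
      move=> yw; apply: cond; first exact: map_f.
      by rewrite /bump; lia.
    rewrite leqNgt; apply/negP => lt; move: yw; rewrite mw' /bump; lia.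
  by rewrite xy /=; case: ifP; rewrite !inE eqxx ?orbT.
- move=> xf; have {xf} -> : x = y.+1.
    by move: xf; rewrite /=; case: eqP => y1; rewrite !inE; lia.
  by move=> _ /mapP[z zw ->]; rewrite /bump; lia.
(* If [3 <= x <= y], then 1 and 2 are both in [w]: two entries below [x]. *)
- move=> cond; have x2 : x <= 2.
    rewrite leqNgt; apply/negP => x3.
    have b1 : 1 \in map (bump x) w.
      by apply/mapP; exists 1; rewrite ?mw' /bump; lia.
    have b2 : 2 \in map (bump x) w.
      by apply/mapP; exists 2; rewrite ?mw' /bump; lia.
    have := cond 1 2 b1 b2; lia.
  by rewrite /=; case: eqP => y1; rewrite !inE; lia.
move=> xf b c /mapP[b' bw ->] /mapP[c' cw ->].
have := mw b'; have := mw c'; rewrite !inE bw cw !orbT.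
have : x <= 2 by move: xf; rewrite /=; case: eqP => y1; rewrite !inE; lia.
by rewrite /bump; lia.
Qed.

Lemma mem_words n w : w \in words n <-> perm_eq w (iota 1 n) /\ avoids w.
Proof.
elim: n w => [|n IH] w.
  rewrite inE; split=> [/eqP->|[/perm_nilP-> _] //].
  by split=> //; apply: avoids_small.
have le x v : perm_eq v (iota 1 n) -> x \in first_entries v -> 0 < x <= n.+1.
  case: v => [|y v] pv; first by rewrite inE => /eqP->.
  have := perm_mem pv y; rewrite mem_head mem_iota => yn.
  by rewrite /=; case: ifP => _; rewrite !inE; lia.
split=> [/allpairsPdep[v [x [/IH[pv av] xv ->]]]|[pw av]].
  have xn := le x v pv xv; split; first by rewrite prepend_perm.
  by apply/(avoids_prepend pv xn).
case: w pw av => [|x w] pw av; first by have := perm_size pw; rewrite size_iota.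
have xn : 0 < x <= n.+1.
  by have := perm_mem pw x; rewrite mem_head mem_iota; lia.
have Ew : x :: w = prepend x (map (unbump x) w).
  congr cons; rewrite -map_comp -[LHS]map_id; apply/eq_in_map => z zw /=.
  rewrite unbumpK // inE; have := perm_uniq pw; rewrite iota_uniq /= => /andP[xw _].
  by apply: contraNneq xw => <-.
move: pw av; rewrite Ew prepend_perm // => pv /(avoids_prepend pv xn)[av xf].
by apply/allpairsPdep; exists (map (unbump x) w), x; split=> //; apply/IH.
Qed.

Lemma uniq_words n : uniq (words n).
Proof.
elim: n => // n IH; apply: allpairs_uniq_dep => //.
  move=> [|y w] /mem_words[pw _] //=; have := perm_mem pw y.
  by rewrite mem_head mem_iota; case: eqP => y1 /=; rewrite !inE; lia.
move=> [v x] [w y] _ _ /= [<-] /(inj_map (@bump_inj x)) -> //.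
Qed.

(** * Counting *)

Lemma dyck_map f h w : {mono f : x y / x < y} -> dyck h (map f w) = dyck h w.
Proof.
move=> fm; elim: w h => [|x [|y w] IH] h //.
by rewrite !map_cons !dyck_cons2 fm -!map_cons !IH.
Qed.

Definition dyck_count n h := count (dyck h) (words n).

(* These words admit only two first entries instead of three. *)
Definition dyck_count1 n h :=
  count (fun w => (head 0 w == 1) && dyck h w) (words n).

Lemma count_sum (T : Type) (a : pred T) s : count a s = \sum_(x <- s) a x.
Proof. by elim: s => [|x s IH]; rewrite ?big_nil // big_cons -IH. Qed.

Lemma count_words a n :
  count a (words n.+1) =
  \sum_(w <- words n) count (fun x => a (prepend x w)) (first_entries w).
Proof.
rewrite count_flatten sumnE !big_map; apply: eq_bigr => w _.
by rewrite count_map; apply: eq_count.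
Qed.

Lemma dyck_prepend h x y w : dyck h (prepend x (y :: w)) =
  if y < x then dyck h.+1 (y :: w) else (0 < h) && dyck h.-1 (y :: w).
Proof.
rewrite /prepend map_cons dyck_cons2 -map_cons !(dyck_map _ _ (ltn_bump x)).
by have -> : (bump x y < x) = (y < x) by rewrite /bump; lia.
Qed.

Lemma words_cons n w : w \in words n.+1 -> exists y v, w = y :: v /\ 0 < y.
Proof.
move=> /mem_words[pw _]; case: w pw => [|y v] pw.
  by have := perm_size pw; rewrite size_iota.
by exists y, v; have := perm_mem pw y; rewrite mem_head mem_iota => /esym/andP[].
Qed.

Lemma count_first_entries a y w :
  count a (first_entries (y :: w)) = a 1 + ((y != 1) && a 2) + a y.+1.
Proof. by rewrite /=; case: (y == 1); rewrite /= !addn0 ?addnA. Qed.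

(** A path from the axis starts with a descent, and only the entry just above the old first one
    creates it. *)
Lemma dyck_count_rec0 n : dyck_count n.+2 0 = dyck_count n.+1 1.
Proof.
rewrite /dyck_count count_words count_sum; apply: eq_big_seq => w.
move=> /words_cons[y [v [-> y0]]]; rewrite count_first_entries !dyck_prepend.
rewrite ltnSn [y < 1]ltnNge y0; case: (ltnP y 2) => y2; last by rewrite /= andbF.
by rewrite (_ : y == 1) //; lia.
Qed.

(** One new first entry makes a descent and two make an ascent, except that a word starting with 1
    has a single ascent. The correction stands on the left to avoid truncated subtraction. *)
Lemma dyck_count_rec n h : dyck_count n.+2 h.+1 + dyck_count1 n.+1 h =
  dyck_count n.+1 h.+2 + (dyck_count n.+1 h).*2.
Proof.
rewrite /dyck_count /dyck_count1 count_words !count_sum -addnn -!big_split.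
apply: eq_big_seq => w /words_cons[y [v [-> y0]]].
rewrite count_first_entries !dyck_prepend ltnSn [y < 1]ltnNge y0 [head _ _]/=.
case: (y =P 1) => y1; first by rewrite /=; lia.
by rewrite (_ : (y < 2) = false) /=; lia.
Qed.

Lemma dyck_count1_rec0 n : dyck_count1 n.+2 0 = 0.
Proof.
rewrite /dyck_count1 count_words big1_seq // => w /andP[_].
move=> /words_cons[y [v [-> y0]]]; rewrite count_first_entries !dyck_prepend /=.
by rewrite [y < 1]ltnNge y0 /= andbF; case: y y0.
Qed.

(** Putting 1 in front is always allowed and creates an ascent; this is the source of the term
    Y_(h-2). *)
Lemma dyck_count1_rec n h : dyck_count1 n.+2 h.+1 = dyck_count n.+1 h.
Proof.
rewrite /dyck_count1 /dyck_count count_words count_sum; apply: eq_big_seq => w.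
move=> /words_cons[y [v [-> y0]]]; rewrite count_first_entries !dyck_prepend /=.
by rewrite [y < 1]ltnNge y0 /= andbF addn0; case: y y0 => //= y _; rewrite addn0.
Qed.

(** * Powers of T and the solution of the recurrence *)

Import GRing.Theory.
Local Open Scope ring_scope.

(* The coefficient of x^u in T^i, where T = 1 + x T^3. *)
Definition ternary_coef (u i : nat) : int :=
  if u is v.+1
  then 'C(3 * v + 2 + i, v.+1)%:Z - 2 * 'C(3 * v + 2 + i, v)%:Z
  else 1.

(** This is T^(i+1) - T^i = x T^(i+3); for the binomial formula it amounts to Pascal's rule. *)
Lemma ternary_coef_step u i :
  ternary_coef u.+1 i.+1 - ternary_coef u.+1 i = ternary_coef u (i + 3)%N.
Proof.
case: u => [|u] /=; first by rewrite !bin1 !bin0; lia.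
have -> : (3 * u.+1 + 2 + i.+1 = (3 * u + 5 + i).+1)%N by lia.
have -> : (3 * u.+1 + 2 + i = 3 * u + 5 + i)%N by lia.
have -> : (3 * u + 2 + (i + 3) = 3 * u + 5 + i)%N by lia.
by rewrite !binS; lia.
Qed.

Lemma ternary_coef0 u : ternary_coef u 0 = (u == 0%N)%:Z.
Proof.
case: u => //= u; rewrite addn0; have := mul_bin_left (3 * u + 2) u.
have -> : (3 * u + 2 - u = u.+1.*2)%N by lia.
by rewrite -muln2 -mulnA => /eqP; rewrite eqn_pmul2l // => /eqP; lia.
Qed.

Lemma ternary_coef1 k : (2 * k + 1)%N%:Z * ternary_coef k 1 = 'C(3 * k, k)%:Z.
Proof.
case: k => [|u] /=; first by rewrite bin0.
have -> : (3 * u + 2 + 1 = 3 * u.+1)%N by lia.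
have := mul_bin_left (3 * u.+1) u.
have -> : (3 * u.+1 - u = 2 * u + 3)%N by lia.
nia.
Qed.

(* If f0 i and f1 i are the coefficients of T^i Q_0 and T^i Q_1 at some power
   of x, the j-th function gives those of T^i Q_j, where
   Q_(j+2) = (T + T^2) Q_(j+1) - T^2 Q_j. *)
Fixpoint shift_rec (f0 f1 : nat -> int) j : nat -> int :=
  match j with
  | 0%N => f0
  | 1%N => f1
  | (j1.+1 as j2).+1 => fun i =>
    shift_rec f0 f1 j2 i.+1 + shift_rec f0 f1 j2 i.+2 - shift_rec f0 f1 j1 i.+2
  end.

Lemma pair_ind (P : nat -> Prop) : P 0%N -> P 1%N ->
  (forall j, P j -> P j.+1 -> P j.+2) -> forall j, P j.
Proof.
by move=> P0 P1 PS j; suff [] : P j /\ P j.+1 by []; elim: j => // j []; auto.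
Qed.

(* Coefficient of x^u in T^i Q_j, for Q_0 = Q_1 = 1; hence Q_2 = T. *)
Definition qcoef u := shift_rec (ternary_coef u) (ternary_coef u).

(* Coefficient of x^u in T^i Q_(j+3) / T^3. *)
Definition scoef u := shift_rec (ternary_coef u)
  (fun i => ternary_coef u i.+2 + ternary_coef u i.+1 - ternary_coef u i).

Lemma qcoefSS u j i : qcoef u j.+2 i =
  qcoef u j.+1 i.+1 + qcoef u j.+1 i.+2 - qcoef u j i.+2.
Proof. by []. Qed.

Lemma scoefSS u j i : scoef u j.+2 i =
  scoef u j.+1 i.+1 + scoef u j.+1 i.+2 - scoef u j i.+2.
Proof. by []. Qed.

Lemma qcoef3 u j i : qcoef u j.+3 i = scoef u j (i + 3)%N.
Proof.
rewrite addn3; elim/pair_ind: j i => [||j IH1 IH2] i.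
- by rewrite /qcoef /scoef /=; lia.
- by rewrite /qcoef /scoef /=; lia.
by rewrite qcoefSS scoefSS !IH2 IH1.
Qed.

(** In series, Q_(j+2) - 2 Q_(j+1) + Q_j = (T - 1) Q_(j+3) / T^3. Both sides obey the same
    recurrence in [j], so it suffices to check [j = 0] and [j = 1]. *)
Lemma qcoef_diff u j i : qcoef u j.+2 i - 2 * qcoef u j.+1 i + qcoef u j i =
  scoef u j i.+1 - scoef u j i.
Proof.
elim/pair_ind: j i => [||j IH1 IH2] i.
- by rewrite /qcoef /scoef /=; lia.
- by rewrite /qcoef /scoef /=; lia.
rewrite (qcoefSS u j.+2 i) (qcoefSS u j.+1 i) (qcoefSS u j i) !(scoefSS u j).
have := IH1 i.+2; have := IH2 i.+1; have := IH2 i.+2.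
lia.
Qed.

Lemma scoef_step u j i :
  scoef u.+1 j i.+1 - scoef u.+1 j i = scoef u j (i + 3)%N.
Proof.
have step k := ternary_coef_step u k.
elim/pair_ind: j i => [||j IH1 IH2] i; first exact: step.
  have := step i; have := step i.+1; have := step i.+2.
  by rewrite /scoef /shift_rec !addSn; lia.
rewrite !scoefSS; have := IH1 i.+2; have := IH2 i.+1; have := IH2 i.+2.
by rewrite !addSn; lia.
Qed.

(** As T - 1 = x T^3, the second difference of the Q_j is x Q_(j+3): the recurrence of Y_h with Y_h
    = Q_(h+2). *)
Lemma qcoef_rec u j :
  qcoef u.+1 j.+2 0 - 2 * qcoef u.+1 j.+1 0 + qcoef u.+1 j 0 = qcoef u j.+3 0.
Proof. by rewrite qcoef_diff scoef_step qcoef3. Qed.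

Lemma qcoef_u0 j i : qcoef 0 j i = 1.
Proof.
elim/pair_ind: j i => [||j IH1 IH2] i //.
by rewrite qcoefSS IH1 !IH2.
Qed.

(** A path of [n] steps is too short to come down from height [h.+1]. *)
Lemma dyck_count_small n h : (n <= h)%N ->
  dyck_count n.+1 h.+1 = 0%N /\ dyck_count1 n.+1 h.+1 = 0%N.
Proof.
elim: n h => [|n IH] [|h] // nh.
rewrite dyck_count1_rec; have [dc d1] := IH h nh.
have [dc2 _] := IH h.+2 (leq_trans (nh : (n <= h)%N) (leq_addl 2 h)).
by have := dyck_count_rec n h.+1; lia.
Qed.

(** A path of [n] steps from height [h] to the axis has [u] up steps and [u + h] down steps, so the
    counts are coefficients of x^u, in Y_h = Q_(h+2) and, for words starting with 1, in Y_(h-1) =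
    Q_(h+1). *)
Lemma dyck_count_coef n u h : n = (2 * u + h)%N ->
  (dyck_count n.+1 h)%:Z = qcoef u h.+2 0 /\
  (dyck_count1 n.+1 h)%:Z = qcoef u h.+1 0.
Proof.
elim: n u h => [|n IH] u h nuh.
  have -> : u = 0%N by lia.
  have -> : h = 0%N by lia.
  by rewrite !qcoef_u0.
case: h nuh => [|h] nuh.
  case: u nuh => [|u] nuh; first by lia.
  (* Q_0 = Q_1 = 1 has no positive power of x, so the boundary case fits the general recurrence. *)
  have q0 : qcoef u.+1 0 0 = 0 by apply: (ternary_coef0 u.+1).
  have q1 : qcoef u.+1 1 0 = 0 by apply: (ternary_coef0 u.+1).
  rewrite dyck_count_rec0 dyck_count1_rec0 q1; split=> //.
  have [|-> _] := IH u 1%N; first lia.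
  by have := qcoef_rec u 0; lia.
rewrite dyck_count1_rec; have [|dc d1] := IH u h; first lia.
split=> //; have := dyck_count_rec n h.
case: u nuh dc d1 => [|u] nuh; rewrite ?qcoef_u0 => dc d1.
  (* With [u = 0], a first step up would leave the path too high to come down. *)
  have [|d2 _] := @dyck_count_small n h.+1; lia.
have [|d2 _] := IH u h.+2; first lia.
by have := qcoef_rec u h.+1; lia.
Qed.

(** The two directions between unique preimages and Dyck words meet here; [n] is positive because
    [dyck] rejects the empty word. *)
Lemma card_U n : (0 < n)%N ->
  #|U n [:: [:: 3; 1; 2]; [:: 3; 4; 2; 1]]%N| = dyck_count n 0.
Proof.
move=> n0; rewrite /dyck_count -size_filter cardE -(size_map (@one_line n)).
apply/perm_size/uniq_perm.
- by rewrite (map_inj_uniq (@one_line_inj _)) enum_uniq.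
- by rewrite filter_uniq ?uniq_words.
move=> w; rewrite mem_filter; apply/mapP/andP => [[p]|[dw /mem_words[pw av]]].
  rewrite mem_enum inE => /andP[/uniquely_sortedP us /avoids_allP av] ->.
  split; last by apply/mem_words; split; [apply: one_line_perm|].
  apply: dyck_of_unique_preimage us.
  by rewrite -size_eq0 (perm_size (one_line_perm p)) size_iota -lt0n.
have [p Ep] := one_line_surj pw; exists p => //.
rewrite mem_enum inE; apply/andP; split; last by apply/avoids_allP; rewrite Ep.
apply/uniquely_sortedP; apply: unique_preimage_of_dyck; rewrite Ep //.
- by rewrite -Ep uniq_one_line.
- by case: av.
Qed.

Theorem theorem5p4 (k : nat) :
  #|U (2 * k + 1)%N [:: [:: 3; 1; 2]; [:: 3; 4; 2; 1]]%N|%:R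
    = (2 * k + 1)%N%:R^-1 * 'C(3 * k, k)%:R :> rat.
Proof.
have k0 : (2 * k + 1)%N%:R != 0 :> rat by rewrite addn1 Num.Theory.pnatr_eq0.
apply: (canRL (mulKf k0)); rewrite -natrM; congr _%:R.
(* Y_0 = Q_2 = T, taken at x^k: the [2 * k] steps contain [k] up steps. *)
have E : (dyck_count (2 * k + 1) 0)%:Z = ternary_coef k 1.
  rewrite addn1; have [|-> _] := @dyck_count_coef (2 * k) k 0; first by rewrite addn0.
  by rewrite /qcoef /=; lia.
rewrite card_U ?addn1 // -addn1.
by have := ternary_coef1 k; rewrite -E; lia.
Qed.
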